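(* Let $p>3$ be a prime. Then $$\sum_{k=0}^{p-1}\frac{\binom{3k}{k}}{432^k}T_{3k}(6,1)\equiv 1\pmod p.$$
   Context: For $n\in\mathbb{N}=\{0,1,2,\ldots\}$ and $b,c\in\mathbb{C}$, the generalized central trinomial coefficient is $T_n(b,c)=[x^n](x^2+bx+c)^n=\sum_{j=0}^{\lfloor n/2\rfloor}\binom{n}{2j}\binom{2j}{j}b^{n-2j}c^j$. Congruences between rational numbers modulo $p$ are understood in the ring of rational numbers whose denominators are prime to $p$ (equivalently in $\mathbb{Z}_p$). *)

(* Defs.v *)
From HB Require Import structures.
From mathcomp Require Import all_boot all_order all_algebra.

Set Implicit Arguments.
Unset Strict Implicit.
Unset Printing Implicit Defensive.

Import GRing.Theory.
Local Open Scope ring_scope.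

(* Over an arbitrary commutative ring, so that b and c may be complex numbers
   as well as rationals. *)
Definition trinomial_coef (R : comNzRingType) (n : nat) (b c : R) : R :=
  (('X^2 + b *: 'X + c%:P) ^+ n)`_n.

Definition p_integral (p : nat) (x : rat) : bool := coprime p `|denq x|%N.

(* Congruence in the ring of p-integral rationals: both sides must belong to
   that ring, and their difference to the ideal generated by p. *)
Definition rat_eqmod (p : nat) (x y : rat) : Prop :=
  [/\ p_integral p x, p_integral p y
    & exists2 z : rat, p_integral p z & x - y = p%:R * z].

(* Main.v *)
Require Import Defs.
From HB Require Import structures.
From mathcomp Require Import all_boot all_order all_algebra.
From mathcomp Require Import ring zify.

(** Write T_n for trinomial_coef n 6 1.  Since 12^3 = 4 * 432 and the coefficient
of s^m in D^m, for D = 1 + 4 s^3, is C(3k,k) 4^k when m = 3k and zero when 3 does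
not divide m, the sum of the theorem is the constant term in s of the sum over
m < 3p of T_m (D / (12 s))^m.  Dropping the condition that 3 divides m is what
makes this sum tractable: it is a truncated geometric series of a trinomial.

Modulo p it has a closed form.  The congruence T_{ip+j} = T_i T_j (for j < p)
splits it into p-blocks, each carrying the same
factor, the sum over j < p of T_j y^j z^(p-1-j) with y = D and z = 12 s.  As
(a - b)^(p-1) is the sum of the a^i b^(p-1-i) in characteristic p, this factor is
the coefficient of x^(p-1) in (y (x^2 + 6 x + 1) - z x)^(p-1), and the middle
coefficient of the (p-1)-st power of a quadratic polynomial is its discriminant to
the power (p-1)/2.  Here the discriminant is

  (6 D - 12 s)^2 - 4 D^2 = 16 (D - 3 s) (2 D - 3 s)
                         = 16 (1 - 2 s)^2 (1 + s) (2 - 3 s + 8 s^3),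

and the square factor (1 - 2 s)^2 is the reason why the sum is explicit.  Put
r = ((1 + s) (2 - 3 s + 8 s^3))^((p-1)/2) and f = (1 - 2 s)^(p-1) r.  By degree
considerations only the blocks i = 0 and i = 1, with T_0 = 1 and T_1 = 6,
contribute, and the sum becomes f_{p-1} + f_{2p-1} / 2.  Because (1 - 2 s)^(p-1) is
the sum of the 2^i s^i for i < p, this combination of coefficients is exactly the
value of r at s = 1/2, that is (9/4)^((p-1)/2) = (3/2)^(p-1) = 1. *)

Set Implicit Arguments.
Unset Strict Implicit.
Unset Printing Implicit Defensive.

Import GRing.Theory.
Local Open Scope ring_scope.

(** * Powers and middle coefficients in characteristic p *)

Lemma sum_multiples (V : nmodType) (d n : nat) (f : nat -> V) :
    (0 < d)%N -> (forall m, ~~ (d %| m)%N -> f m = 0) ->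
  \sum_(0 <= m < n * d) f m = \sum_(0 <= k < n) f (k * d)%N.
Proof.
move=> d_gt0 f0; rewrite big_nat_mul; apply: eq_bigr => k _.
rewrite big_ltn ?ltn_pmul2r // big_nat big1 ?Monoid.mulm1 // => m.
case/andP=> lt_kd_m lt_m_kd.
apply: f0; apply/negP => /dvdnP[l eq_m].
move: lt_kd_m lt_m_kd; rewrite eq_m !ltn_pmul2r // ltnS => lt_kl le_lk.
by have := leq_trans lt_kl le_lk; rewrite ltnn.
Qed.

Lemma natr_exp_pchar (R : comNzRingType) (p n : nat) :
  p \in [pchar R] -> n%:R ^+ p = n%:R :> R.
Proof. by move=> pchR; rewrite -(pFrobenius_autE pchR) pFrobenius_aut_nat. Qed.

Lemma natr_exp_pred_pchar (F : fieldType) (p n : nat) :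
  p \in [pchar F] -> n%:R != 0 :> F -> n%:R ^+ p.-1 = 1 :> F.
Proof.
move=> pchF n_neq0; apply: (mulfI n_neq0).
rewrite -exprS prednK ?prime_gt0 ?(pcharf_prime pchF) //.
by rewrite natr_exp_pchar ?mulr1.
Qed.

Lemma natr_mulr_scale (R : comNzRingType) (n : nat) (q : {poly R}) :
  n%:R * q = n%:R *: q.
Proof. by rewrite mulr_natl scaler_nat. Qed.

Lemma size_exp_le (R : nzSemiRingType) (q : {poly R}) (d n : nat) :
  (size q <= d.+1)%N -> (size (q ^+ n) <= (d * n).+1)%N.
Proof. by move=> size_q; have := size_poly_exp_leq q n; nia. Qed.

(** Both sides multiplied by a - b give a^p - b^p, by Frobenius on the left; when
a = b, the right-hand side consists of p equal terms. *)
Lemma exprB_pred_pchar (R : idomainType) (p : nat) (a b : R) :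
    p \in [pchar R] ->
  (a - b) ^+ p.-1 = \sum_(0 <= i < p) a ^+ i * b ^+ (p.-1 - i).
Proof.
move=> pchR; have p_pr := pcharf_prime pchR; have p_gt1 := prime_gt1 p_pr.
have p_gt0 := ltnW p_gt1.
have [->|neq_ab] := eqVneq a b.
  rewrite subrr expr0n (_ : (p.-1 == 0)%N = false); last by lia.
  rewrite (eq_big_nat _ _ (F2 := fun=> b ^+ p.-1)) => [|i /andP[_ lt_ip]].
    by rewrite sumr_const_nat subn0 (mulrn_pchar pchR).
  by rewrite -exprD subnKC // -ltnS prednK.
have neq0 : a - b != 0 by rewrite subr_eq0.
apply: (mulfI neq0); rewrite -exprS prednK //.
rewrite -(pFrobenius_autE pchR) (pFrobenius_autB_comm _ (mulrC a b)).
rewrite !pFrobenius_autE.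
rewrite -opprB subrXX -mulNr opprB big_mkord; congr (_ * _).
by apply: eq_bigr => i _; rewrite mulrC.
Qed.

(** The binomial is a linear polynomial in X^d, so that only exponents divisible
by d occur. *)
Lemma coef_exp_binomial (R : comNzRingType) (d m : nat) (a c : R) :
    (0 < d)%N ->
  ((a *: 'X^d + c%:P) ^+ m)`_m =
    if (d %| m)%N then
      'C(m, m %/ d)%:R * (a ^+ (m %/ d) * c ^+ (m - m %/ d))
    else 0.
Proof.
move=> d_gt0.
have -> : (a *: 'X^d + c%:P) ^+ m = (c%:P + a *: 'X) ^+ m \Po 'X^d.
  by rewrite rmorphXn /= comp_polyD comp_polyZ comp_polyX comp_polyC addrC.
rewrite coef_comp_poly_Xn //; case: ifP => // _.
rewrite exprDn.
under eq_bigr => i _ do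
  rewrite -rmorphXn exprZn /= mul_polyC scalerA scalerMnl.
rewrite -(poly_def _ (fun i => c ^+ (m - i) * a ^+ i *+ 'C(m, i))).
by rewrite coef_poly ltnS leq_div mulr_natl [c ^+ _ * _]mulrC.
Qed.

(** Since h = -1/2 in R, this is the identity C(2j, j) = (-4)^j C(-1/2, j) of
characteristic 0. *)
Lemma central_bin_pchar (R : idomainType) (p h j : nat) :
    p \in [pchar R] -> p = h.*2.+1 -> (j <= h)%N ->
  'C(j * 2, j)%:R = (- 4%:R) ^+ j * 'C(h, j)%:R :> R.
Proof.
move=> pchR def_p; elim: j => [|j IHj] lt_jh; first by rewrite !bin0 mulr1.
have j1_neq0 : j.+1%:R != 0 :> R.
  by rewrite -(dvdn_pcharf pchR) gtnNdvd // def_p; lia.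
apply: (mulfI j1_neq0).
have bin_step : (j.+1 * 'C(j.+1 * 2, j.+1) = 2 * (j * 2).+1 * 'C(j * 2, j))%N.
  rewrite -[(j.+1 * 2)%N]/(j * 2).+2 -mul_bin_diag /=.
  have := mul_bin_down (j * 2).+1 j; rewrite /= (_ : (_ - j = j.+1)%N); last by lia.
  nia.
have bin_step' : j.+1%:R * 'C(h, j.+1)%:R = (h%:R - j%:R) * 'C(h, j)%:R :> R.
  by rewrite -natrM mul_bin_left natrM natrB // ltnW.
have h2 : 2%:R * h%:R = - 1 :> R.
  by apply/eqP; rewrite -addr_eq0 -natrM natr1 mul2n -def_p pcharf0 ?eqxx.
rewrite -natrM bin_step [in LHS]natrM IHj; last exact: ltnW.
rewrite exprS [RHS]mulrCA bin_step' -mulrA mulrA.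
have -> : (2 * (j * 2).+1)%:R = - 4%:R * (h%:R - j%:R) :> R.
  rewrite (_ : _ * (_ - _) = - 2%:R * (2%:R * h%:R) + 4%:R * j%:R);
    last by ring.
  by rewrite h2 natrM -[(j * 2).+1%:R]natr1 natrM; ring.
ring.
Qed.

(** Expanding around b X with exprB_pred_pchar, the term of degree p - 1 is a sum
of central binomial coefficients, which central_bin_pchar turns into the binomial
expansion of a power of the discriminant. *)
Lemma coef_quadratic_pchar (R : idomainType) (p h : nat) (a b c : R) :
    p \in [pchar R] -> p = h.*2.+1 ->
  ((a *: 'X^2 + b *: 'X + c%:P) ^+ p.-1)`_p.-1 = (b ^+ 2 - 4%:R * a * c) ^+ h.
Proof.
move=> pchR def_p.
have pchRX : p \in [pchar {poly R}] by rewrite pchar_poly.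
have -> : a *: 'X^2 + b *: 'X + c%:P = (a *: 'X^2 + c%:P) - (- b) *: 'X.
  by rewrite scaleNr opprK addrAC.
rewrite (exprB_pred_pchar _ _ pchRX) coef_sum.
pose g m := (- b) ^+ (h * 2 - m) * (if (2 %| m)%N then
  'C(m, m %/ 2)%:R * (a ^+ (m %/ 2) * c ^+ (m - m %/ 2)) else 0).
rewrite def_p /= -muln2 (eq_big_nat _ _ (F2 := g)) => [|m /andP[_ le_mh]].
  rewrite big_nat_recr //= sum_multiples // => [|m /negPf ndvd_m]; last first.
    by rewrite /g ndvd_m mulr0.
  rewrite -(big_nat_recr h 0 (fun k => g (k * 2)%N)) //.
  rewrite exprDn big_mkord; apply: eq_bigr => k _.
  have le_kh : (k <= h)%N by rewrite -ltnS.
  rewrite /g dvdn_mull // mulnK // -mulnBl [((h - k) * 2)%N]mulnC exprM sqrrN.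
  rewrite (_ : (k * 2 - k)%N = k); last by lia.
  rewrite -[_ *+ 'C(h, k)]mulr_natl (central_bin_pchar pchR def_p) //.
  have -> : - (4%:R * a * c) = - 4%:R * (a * c) by ring.
  rewrite [(- 4%:R * _) ^+ k]exprMn [(a * c) ^+ k]exprMn.
  by move: ((- 4%:R) ^+ k) 'C(h, k)%:R => u v; ring.
rewrite exprZn -scalerAr coefZ coefMXn ltnNge leq_subr /=.
by rewrite subKn ?coef_exp_binomial.
Qed.

(** As (1 - c X)^(p-1) is the sum of the c^i X^i for i < p, the coefficient of
index p - 1 of f collects the terms of degree < p of r.[c^-1], up to the factor
c^(p-1) = 1, and the coefficient of index 2p - 1 collects those of degree p to
2p - 1, up to c^(2p-1) = c. *)
Lemma coef_mul_linear_pred_pchar (F : fieldType) (p : nat) (c : F) (r : {poly F}) :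
    p \in [pchar F] -> c != 0 -> c ^+ p = c -> (size r <= p.*2)%N ->
  let f := (1 - c *: 'X) ^+ p.-1 * r in f`_p.-1 + c^-1 * f`_p.*2.-1 = r.[c^-1].
Proof.
move=> pchF c_neq0 cp size_r f.
have pchFX : p \in [pchar {poly F}] by rewrite pchar_poly.
have p_gt0 := prime_gt0 (pcharf_prime pchF).
have cp1 : c ^+ p.-1 = 1.
  by apply: (mulfI c_neq0); rewrite -exprS prednK // cp mulr1.
have coef_f n : (p.-1 <= n)%N ->
    f`_n = \sum_(0 <= i < p) r`_(n - (p.-1 - i)) * c ^+ (p.-1 - i).
  move=> le_pn; rewrite /f exprB_pred_pchar // mulr_suml coef_sum.
  apply: eq_big_nat => i /andP[_ lt_ip].
  rewrite expr1n mul1r exprZn -scalerAl coefZ coefXnM mulrC.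
  by have -> : (n < p.-1 - i)%N = false by lia.
rewrite !coef_f //; last by lia.
rewrite (horner_coef_wide _ size_r) -(big_mkord xpredT (fun i => r`_i * c^-1 ^+ i)).
have le_p2p : (p <= p.*2)%N by lia.
rewrite (big_cat_nat (leq0n p) le_p2p) /=; congr (_ + _).
  apply: eq_big_nat => i /andP[_ lt_ip].
  rewrite subKn; last by lia.
  congr (_ * _); rewrite exprVn; apply: (mulIf (expf_neq0 i c_neq0)).
  by rewrite mulVf ?expf_neq0 // -exprD subnK // -ltnS prednK.
have -> : \sum_(p <= i < p.*2) r`_i * c^-1 ^+ i =
          \sum_(0 <= i < p) r`_(i + p) * c^-1 ^+ (i + p).
  by rewrite -{1}[p]add0n big_addn -addnn addnK.
rewrite mulr_sumr; apply: eq_big_nat => i /andP[_ lt_ip].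
rewrite mulrCA; congr (_ * _); first by congr (r`_ _); lia.
rewrite exprVn; apply: (mulIf (expf_neq0 (i + p) c_neq0)).
rewrite mulVf ?expf_neq0 // -mulrA -exprD.
have -> : (p.-1 - i + (i + p) = p.-1 + p)%N by lia.
by rewrite exprD cp1 cp mul1r mulVf.
Qed.

(** * Trinomial coefficients modulo p *)

Lemma rmorph_trinomial_coef (R S : comNzRingType) (f : {rmorphism R -> S})
    (n : nat) (b c : R) :
  f (trinomial_coef n b c) = trinomial_coef n (f b) (f c).
Proof.
rewrite /trinomial_coef -coef_map rmorphXn !rmorphD /=.
by rewrite map_polyXn map_polyZ map_polyX map_polyC.
Qed.

(** For q = X^2 + b X + c, the hypotheses on b and c give q^p = q(X^p), whose
exponents are multiples of p; as q^j has degree 2j < p + j, no carry from one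
multiple of p to another can occur. *)
Lemma trinomial_coef_Lucas (R : comNzRingType) (p i j : nat) (b c : R) :
    p \in [pchar R] -> b ^+ p = b -> c ^+ p = c -> (j < p)%N ->
  trinomial_coef (i * p + j) b c = trinomial_coef i b c * trinomial_coef j b c.
Proof.
move=> pchR bp cp lt_jp; rewrite /trinomial_coef exprD mulnC exprM.
have pchRX : p \in [pchar {poly R}] by rewrite pchar_poly.
have p_gt0 := prime_gt0 (pcharf_prime pchR).
set q := _ + c%:P.
have size_q n : (size (q ^+ n) <= (n * 2).+1)%N.
  have size_q3 : (size q <= 3)%N.
    rewrite /q -addrA (leq_trans (size_polyD _ _)) // size_polyXn geq_max leqnn /=.
    rewrite (leq_trans (size_polyD _ _)) // geq_max.
    rewrite (leq_trans (size_scale_leq _ _)) ?size_polyX //.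
    by rewrite (leq_trans (size_polyC_leq1 _)).
  by have := size_poly_exp_leq q n; nia.
have -> : q ^+ p = q \Po 'X^p.
  rewrite /q !exprDn_pchar ?pnatE ?(pcharf_prime pchR) //.
  rewrite exprZn bp -rmorphXn cp !comp_polyD comp_polyZ comp_polyX comp_polyC /=.
  by rewrite comp_Xn_poly -!exprM mulnC.
rewrite -rmorphXn /= coefM.
have lt_ip : (p * i < (p * i + j).+1)%N by rewrite ltnS leq_addr.
rewrite (bigD1 (Ordinal lt_ip)) //= coef_comp_poly_Xn // dvdn_mulr // mulKn // addKn.
rewrite big1 ?addr0 // => l neq_l; rewrite coef_comp_poly_Xn //.
case: ifP => [/dvdnP[k def_l]|]; last by rewrite mul0r.
rewrite [X in _ * X]nth_default ?mulr0 // (leq_trans (size_q j)) //.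
have neq_ki : k != i.
  by apply: contra neq_l => /eqP eq_ki; rewrite -val_eqE /= def_l eq_ki mulnC.
have := ltn_ord l; rewrite def_l mulnC ltnS => le_ki.
have lt_ki : (k < i)%N by rewrite ltn_neqAle neq_ki; nia.
nia.
Qed.

(** The sum is the coefficient of X^(p-1) in (y (X^2 + b X + c) - z X)^(p-1), a
power of a quadratic polynomial of discriminant (b y - z)^2 - 4 c y^2. *)
Lemma sum_trinomial_coef_lt (R : idomainType) (p h : nat) (b c y z : R) :
    p \in [pchar R] -> p = h.*2.+1 ->
  \sum_(0 <= j < p) trinomial_coef j b c * (y ^+ j * z ^+ (p.-1 - j)) =
    ((b * y - z) ^+ 2 - 4%:R * c * y ^+ 2) ^+ h.
Proof.
move=> pchR def_p; have pchRX : p \in [pchar {poly R}] by rewrite pchar_poly.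
transitivity ((y *: ('X^2 + b *: 'X + c%:P) - z *: 'X) ^+ p.-1)`_p.-1.
  rewrite exprB_pred_pchar // coef_sum; apply: eq_big_nat => j /andP[_ lt_jp].
  rewrite !exprZn -scalerAl -scalerAr !coefZ coefMXn ltnNge leq_subr /=.
  by rewrite subKn 1?mulrC ?mulrA //; lia.
have -> : y *: ('X^2 + b *: 'X + c%:P) - z *: 'X =
          y *: 'X^2 + (b * y - z) *: 'X + (y * c)%:P.
  by rewrite -!mul_polyC polyCB !polyCM; ring.
rewrite (coef_quadratic_pchar _ _ _ pchR def_p).
by congr (_ ^+ _); ring.
Qed.

Lemma sum_trinomial_coef_blocks (R : idomainType) (p h n : nat) (b c y z : R) :
    p \in [pchar R] -> p = h.*2.+1 -> b ^+ p = b -> c ^+ p = c ->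
  \sum_(0 <= m < n * p) trinomial_coef m b c * (y ^+ m * z ^+ ((n * p).-1 - m)) =
    (\sum_(0 <= i < n) trinomial_coef i b c *
        ((y ^+ p) ^+ i * (z ^+ p) ^+ (n.-1 - i)))
    * ((b * y - z) ^+ 2 - 4%:R * c * y ^+ 2) ^+ h.
Proof.
move=> pchR def_p bp cp; rewrite big_nat_mul mulr_suml.
apply: eq_big_nat => i /andP[_ lt_in].
rewrite -(sum_trinomial_coef_lt _ _ _ _ pchR def_p) mulr_sumr.
rewrite -[X in \sum_(X <= _ < _) _]add0n big_addn mulSn addnK.
apply: eq_big_nat => j /andP[_ lt_jp].
rewrite addnC (trinomial_coef_Lucas _ pchR bp cp lt_jp) -!exprM.
have -> : ((n * p).-1 - (i * p + j) = p * (n.-1 - i) + (p.-1 - j))%N by nia.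
by rewrite !exprD [(p * i)%N]mulnC; ring.
Qed.

(** * The sum in characteristic p *)

(** Homogenizing with powers of 12 X replaces a constant term of a Laurent
polynomial by a coefficient of a polynomial. *)
Lemma sum_bin_trinomial_coef_generating (F : fieldType) (n : nat) :
    2%:R != 0 :> F -> 3%:R != 0 :> F -> (0 < n)%N ->
  (\sum_(0 <= m < n * 3) trinomial_coef m (6%:R : {poly F}) 1 *
      ((1 + 4%:R * 'X^3) ^+ m * (12%:R * 'X) ^+ ((n * 3).-1 - m)))`_(n * 3).-1 =
  12%:R ^+ (n * 3).-1 * \sum_(0 <= k < n)
    'C(3 * k, k)%:R / 432%:R ^+ k * trinomial_coef (3 * k) (6%:R : F) 1.
Proof.
move=> F2 F3 n_gt0.
have n12 : 12%:R != 0 :> F by rewrite (natrM _ 4 3) (natrM _ 2 2) !mulf_neq0.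
have n432 : 432%:R != 0 :> F by rewrite (natrM _ 36 12) (natrM _ 12 3) !mulf_neq0.
pose g m : F := trinomial_coef m 6%:R 1 * (12%:R ^+ ((n * 3).-1 - m) *
  (if (3 %| m)%N then 'C(m, m %/ 3)%:R * 4%:R ^+ (m %/ 3) else 0)).
rewrite coef_sum (eq_big_nat _ _ (F2 := g)) => [|m /andP[_ lt_mn]].
  rewrite sum_multiples // => [|m /negPf ndvd_m]; last by rewrite /g ndvd_m !mulr0.
  rewrite mulr_sumr; apply: eq_big_nat => k /andP[_ lt_kn].
  rewrite /g dvdn_mull // mulnK // [(k * 3)%N]mulnC.
  have -> : ((n * 3).-1 = (n * 3).-1 - 3 * k + 3 * k)%N by lia.
  rewrite addnK exprD [12%:R ^+ (3 * k)]exprM.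
  have -> : 12%:R ^+ 3 = 4%:R * 432%:R :> F by rewrite -natrX -natrM.
  rewrite exprMn; field.
  by rewrite expf_neq0.
have -> : trinomial_coef m 6%:R 1 = (trinomial_coef m (6%:R : F) 1)%:P.
  by rewrite (rmorph_trinomial_coef (@polyC F)) /= rmorph_nat.
rewrite coefCM !natr_mulr_scale exprZn -scalerAr coefZ coefMXn.
rewrite ltnNge leq_subr /= subKn; last by lia.
rewrite addrC.
by rewrite coef_exp_binomial // expr1n mulr1.
Qed.

(** The square on the right comes from 1 - 3 s + 4 s^3 = (1 - 2 s)^2 (1 + s). *)
Lemma trinomial_disc_factor (F : fieldType) :
  (6%:R * (1 + 4%:R * 'X^3) - 12%:R * 'X) ^+ 2
    - 4%:R * 1 * (1 + 4%:R * 'X^3) ^+ 2 =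
  16%:R * ((1 - 2%:R *: 'X) ^+ 2 * ((1 + 'X) * (2%:R - 3%:R * 'X + 8%:R * 'X^3)))
  :> {poly F}.
Proof. by rewrite -natr_mulr_scale; ring. Qed.

Lemma sum_bin_trinomial_coef_pchar (F : fieldType) (p : nat) :
    p \in [pchar F] -> (3 < p)%N ->
  \sum_(0 <= k < p)
    'C(3 * k, k)%:R / 432%:R ^+ k * trinomial_coef (3 * k) (6%:R : F) 1 = 1.
Proof.
move=> pchF p_gt3; have p_pr := pcharf_prime pchF.
have pchFX : p \in [pchar {poly F}] by rewrite pchar_poly.
have F2 : 2%:R != 0 :> F by rewrite -(dvdn_pcharf pchF) gtnNdvd //; lia.
have F3 : 3%:R != 0 :> F by rewrite -(dvdn_pcharf pchF) gtnNdvd.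
have n12 : 12%:R != 0 :> F by rewrite (natrM _ 4 3) (natrM _ 2 2) !mulf_neq0.
have fermat n : n%:R != 0 :> F -> n%:R ^+ p.-1 = 1 :> F.
  exact: natr_exp_pred_pchar.
have [h def_p] : exists h, p = h.*2.+1.
  exists p./2; have := odd_double_half p.
  by case: (even_prime p_pr) => [p2|->] //; move: p_gt3; rewrite p2.
have p_gt0 := prime_gt0 p_pr.
have c12 : 12%:R ^+ (p * 3).-1 = 12%:R ^+ 2 :> F.
  have -> : ((p * 3).-1 = p.-1 * 3 + 2)%N by lia.
  by rewrite exprD exprM fermat // expr1n mul1r.
apply: (mulfI (expf_neq0 (p * 3).-1 n12)); rewrite mulr1.
rewrite -sum_bin_trinomial_coef_generating // [(p * 3)%N]mulnC.
rewrite (sum_trinomial_coef_blocks _ _ _ pchFX def_p) ?expr1n //;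
  last exact: natr_exp_pchar 6 pchFX.
rewrite trinomial_disc_factor.
(* The power of the discriminant is w, once 16^h = 4^(p-1) = 1 is dropped. *)
set q := (1 + 'X) * _.
pose u : {poly F} := (1 - 2%:R *: 'X) ^+ p.-1; pose w := u * q ^+ h.
have def_q : q = Poly [:: 2%:R; - 1; - 3%:R; 8%:R; 8%:R].
  rewrite /= !cons_poly_def mul0r add0r /q.
  rewrite !rmorphN !rmorph_nat; ring.
have size_q : (size (q ^+ h) <= p.*2.-1)%N.
  apply: leq_trans (size_exp_le (d := 4) h _) _; last by lia.
  by rewrite def_q (leq_trans (size_Poly _)).
have size_w : (size w <= (p * 3).-2)%N.
  have size_u : (size u <= (1 * p.-1).+1)%N.
    apply: size_exp_le; rewrite (_ : 1 - _ = Poly [:: 1; - 2%:R]) ?size_Poly //.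
    by rewrite /= !cons_poly_def mul0r add0r -mul_polyC rmorphN; ring.
  apply: leq_trans (size_polyMleq u (q ^+ h)) _.
  by move: (size u) (size (q ^+ h)) size_u size_q => su sq; lia.
have -> : (16%:R * ((1 - 2%:R *: 'X) ^+ 2 * q)) ^+ h = w.
  have -> : 16%:R = 4%:R%:P ^+ 2 :> {poly F} by rewrite -polyC_exp -natrX rmorph_nat.
  have p1 : p.-1 = (2 * h)%N by lia.
  rewrite exprMn [(_ * q) ^+ h]exprMn -!exprM -p1 -polyC_exp fermat ?mul1r //.
  by rewrite (natrM _ 2 2) mulf_neq0.
have T0 : trinomial_coef 0 (6%:R : {poly F}) 1 = 1.
  by rewrite /trinomial_coef expr0 coef1.
have T1 : trinomial_coef 1 (6%:R : {poly F}) 1 = 6%:R.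
  by rewrite /trinomial_coef expr1 !coefD coefXn coefZ coefX coefC add0r addr0 mulr1.
have Yp : (1 + 4%:R * 'X^3 : {poly F}) ^+ p = 1 + 4%:R * 'X^(3 * p).
  rewrite exprDn_pchar ?pnatE // expr1n exprMn natr_exp_pchar //.
  by rewrite -exprM.
have Zp : (12%:R * 'X : {poly F}) ^+ p = 12%:R * 'X^p.
  by rewrite exprMn natr_exp_pchar.
have [t2 T2] : exists t, trinomial_coef 2 (6%:R : {poly F}) 1 = t%:P.
  exists (trinomial_coef 2 6%:R 1).
  by rewrite (rmorph_trinomial_coef (@polyC F)) /= rmorph_nat.
rewrite !big_nat_recl // big_nil /= addr0 T0 T1 T2 Yp Zp.
(* The coefficient of index 3p - 1 comes from the first two summands: w has degree
   less than 3p - 1, and the last summand is a multiple of 'X^(3 * p). *)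
have -> : (1 * ((1 + 4%:R * 'X^(3 * p)) ^+ 0 * (12%:R * 'X^p) ^+ (2 - 0)) +
   (6%:R * ((1 + 4%:R * 'X^(3 * p)) ^+ 1 * (12%:R * 'X^p) ^+ (2 - 1)) +
    t2%:P * ((1 + 4%:R * 'X^(3 * p)) ^+ 2 * (12%:R * 'X^p) ^+ (2 - 2)))) * w =
  (12%:R ^+ 2)%:P * ('X^(2 * p) * w) + 72%:R%:P * ('X^p * w) + t2%:P * w
  + 'X^(3 * p) * ((288%:R * 'X^p + t2%:P * (8%:R + 16%:R * 'X^(3 * p))) * w)
  :> {poly F}.
  rewrite rmorphXn /= !rmorph_nat [(2 * p)%N]mulnC [(3 * p)%N]mulnC ![ 'X^(p * _)]exprM.
  by move: ('X^p : {poly F}) => v; ring.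
rewrite !coefD !coefCM !coefXnM.
have -> : ((3 * p).-1 < 2 * p)%N = false by lia.
have -> : ((3 * p).-1 < p)%N = false by lia.
have -> : ((3 * p).-1 < 3 * p)%N by lia.
have -> : ((3 * p).-1 - 2 * p = p.-1)%N by lia.
have -> : ((3 * p).-1 - p = p.*2.-1)%N by lia.
rewrite [X in t2 * X]nth_default ?mulr0 ?addr0; last by apply: leq_trans size_w _; lia.
have wE := coef_mul_linear_pred_pchar (r := q ^+ h) pchF F2 (natr_exp_pchar 2 pchF) _.
rewrite [(3 * p)%N]mulnC c12.
have -> : 72%:R = 12%:R ^+ 2 * 2%:R^-1 :> F by field.
rewrite -[12%:R ^+ 2 / 2%:R * _]mulrA -mulrDr wE; last by apply: leq_trans size_q _; lia.
rewrite horner_exp.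
have -> : q.[2%:R^-1] = (3%:R / 2%:R) ^+ 2.
  by rewrite def_q /= !horner_cons hornerC; field.
by rewrite -exprM (_ : (2 * h)%N = p.-1) ?expr_div_n ?fermat ?divr1 ?mulr1 //; lia.
Qed.

(** * From the prime field to p-integral rationals *)

Lemma rat_eqmod1_fraction (p d : nat) (n : int) :
    prime p -> coprime p d -> n%:~R = d%:R :> 'F_p ->
  rat_eqmod p (n%:~R / d%:R) 1.
Proof.
move=> p_pr co_pd eq_nd.
have d_neq0 : d%:R != 0 :> rat.
  rewrite Num.Theory.pnatr_eq0; apply: contraL co_pd => /eqP->.
  by rewrite /coprime gcdn0 neq_ltn prime_gt1 ?orbT.
(* The reduced denominator of m / d divides d. *)
have int_frac m : p_integral p (m%:~R / d%:R).
  have num_d : numq (m%:~R / d%:R) * d%:Z = m * denq (m%:~R / d%:R).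
    apply: (@intr_inj rat); rewrite !rmorphM /= numqE.
    by rewrite mulrAC divfK.
  apply: coprime_dvdr co_pd.
  rewrite -(Gauss_dvdr d (m := `|denq _|%N) (n := `|numq (m%:~R / d%:R)|%N)).
    by rewrite -[d in (_ * d)%N]/`|d%:Z|%N -abszM num_d abszM dvdn_mull.
  by rewrite coprime_sym coprime_num_den.
split=> //; first exact: coprimen1.
have /dvdzP[m def_m] : (p%:Z %| n - d%:Z)%Z.
  by rewrite (dvdz_pcharf (pchar_Fp p_pr)) rmorphB /= eq_nd subrr.
exists (m%:~R / d%:R) => //.
have -> : n = m * p%:Z + d%:Z by rewrite -def_m subrK.
by rewrite rmorphD rmorphM /=; field.
Qed.

Theorem theorem1p3 (p : nat) (p_prime : prime p) (p_gt3 : (3 < p)%N) :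
  rat_eqmod p
    (\sum_(0 <= k < p)
       'C(3 * k, k)%:R / 432%:R ^+ k * trinomial_coef (3 * k) (6%:R : rat) 1)
    1.
Proof.
have pchFp := pchar_Fp p_prime.
(* The integer n is 432^p times the sum; clear_den holds both over rat and over
   'F_p, which transfers the value of the sum from one to the other. *)
pose n : int := \sum_(0 <= k < p)
  'C(3 * k, k)%:R * 432%:R ^+ (p - k) * trinomial_coef (3 * k) 6%:R 1.
have clear_den (F : fieldType) : 432%:R != 0 :> F ->
    \sum_(0 <= k < p) 'C(3 * k, k)%:R / 432%:R ^+ k
      * trinomial_coef (3 * k) (6%:R : F) 1 = n%:~R / (432 ^ p)%:R.
  move=> n432; rewrite natrX; apply: (mulIf (expf_neq0 p n432)).
  rewrite divfK ?expf_neq0 // mulr_suml rmorph_sum /=.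
  apply: eq_big_nat => k /andP[_ lt_kp].
  rewrite !rmorphM rmorphXn (rmorph_trinomial_coef intr) /= !rmorph_nat rmorph1.
  rewrite -[in LHS](subnK (ltnW lt_kp)) exprD.
  by field; rewrite expf_neq0.
have co_p432 : coprime p (432 ^ p).
  rewrite coprimeXr // prime_coprime // (_ : 432 = 2 ^ 4 * 3 ^ 3)%N //.
  by rewrite Euclid_dvdM // !Euclid_dvdX // !andbT !gtnNdvd //; lia.
rewrite clear_den; last by rewrite Num.Theory.pnatr_eq0.
apply: rat_eqmod1_fraction => //.
have n432 : (432 ^ p)%:R != 0 :> 'F_p by rewrite -unitfE unitFpE.
apply: (mulIf (invr_neq0 n432)); rewrite mulfV //.
rewrite -clear_den; first exact: sum_bin_trinomial_coef_pchar.
by apply: contra_neq n432 => z; rewrite natrX z expr0n gtn_eqF ?prime_gt0.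
Qed.
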